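(* Suppose Assumption (G) holds. Let $I\subset\{1,\dots,N\}$ be any index set, $I^c=\{1,\dots,N\}\setminus I$, $f^\dagger\in Y$, and let the sequence $(f^n)_n$ in $Y$ be such that $f_i^n=f_i^\dagger$ for $i\in I^c$ and $f_i^n\overset{D_i}{\to}f_i^\dagger$ as $n\to\infty$ for $i\in I$. Define $\delta_i^n=D_i(f_i^\dagger,f_i^n)^{1/p_i}$ with $p_i\in[1,\infty)$ for $i\in I$ and $\delta_i^n=0$ else. Choose $\lambda^n=(\lambda_1^n,\dots,\lambda_N^n)\in(0,\infty)^N$ such that $\lambda_i^n=\lambda_i^\dagger\in(0,\infty)$ for $i\in I^c$ and $$\lambda_i^n\to\infty\ \text{ as well as }\ \lambda_i^n(\delta_i^n)^{p_i}\to0\quad\text{for }i\in I,$$ and denote $\lambda^\dagger=\lim_{n\to\infty}\lambda^n\in(0,\infty]^N$. Assume that there exists a $J_{\lambda^\dagger,I^c}$-minimal solution to $T_Iu=f_I^\dagger$. Then every sequence $(u^n)_n$ of solutions to $$\min_{u\in\operatorname{dom}(T)}J_{\lambda^n}(u,f^n)$$ admits a $\tau_X$-convergent subsequence, again denoted by $(u^n)_n$, with limit $u^\dagger$ such that $$D_i(T_iu^n,f_i^n)=o((\lambda_i^n)^{-1})\quad\text{for }i\in I,$$ $$\lim_{n\to\infty}D_i(T_iu^n,f_i^\dagger)=D_i(T_iu^\dagger,f_i^\dagger)\quad\text{for }i\in I^c,$$ $$\lim_{n\to\infty}R(u^n)=R(u^\dagger),$$ and every limit of a $\tau_X$-convergent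 subsequence of solutions is a solution to $$\min_{\substack{u\in\operatorname{dom}(T)\\ T_Iu=f_I^\dagger}}J_{\lambda^\dagger}(u,f^\dagger).$$
   Context: Setting. Let $(X,\|\cdot\|_X)$ be a Banach space and $R\colon X\to[0,\infty]$. For $i=1,\dots,N$ let $(Y_i,\|\cdot\|_{Y_i})$ be a normed space, $D_i\colon Y_i\times Y_i\to[0,\infty]$ a data discrepancy, and $T_i\colon \operatorname{dom}(T_i)\subset X\to Y_i$ an operator. Put $\operatorname{dom}(T)=\bigcap_{i=1}^N\operatorname{dom}(T_i)$ and $Y=Y_1\times\cdots\times Y_N$. For $u\in\operatorname{dom}(T)$, $f\in Y$ and $\lambda\in[0,\infty]^N$ let $$J_\lambda(u,f)=\sum_{i=1}^N\lambda_iD_i(T_iu,f_i)+R(u),$$ where for $\lambda_i=\infty$ the term $\lambda_iD_i(T_iu,f_i)$ is $0$ if $D_i(T_iu,f_i)=0$ and $\infty$ otherwise. For $I\subset\{1,\dots,N\}$ put $J_{\lambda,I^c}(u,f)=R(u)+\sum_{i\in I^c}\lambda_iD_i(T_iu,f_i)$; $T_Iu=f_I^\dagger$ means $T_iu=f_i^\dagger$ for all $i\in I$. A $J_{\lambda^\dagger,I^c}$-minimal solution to $T_Iu=f_I^\dagger$ is a minimizer of $J_{\lambda^\dagger,I^c}(\cdot,f^\dagger)$ over $\{u\in\operatorname{dom}(T): T_Iu=f_I^\dagger\}$. Let $\tau_X$ be a Hausdorff topology on $X$, and for each $i$ let $\tau_{Y_i}$ (Hausdorff) and $\tau_{D_i}$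 (arbitrary) be topologies on $Y_i$. Write $f_i^n\overset{D_i}{\to}f_i$ if $D_i(f_i,f_i^n)\to0$ and $f_i^n\to f_i$ in $\tau_{D_i}$ as $n\to\infty$; $f^n\overset{D}{\to}f$ means this holds for every component. Assumption (G): (1) For each $i$ and $a,b\in Y_i$, $D_i(a,b)=0$ implies $a=b$. (2) For each $i$: if $a^n\to a$ in $\tau_{Y_i}$ and $f_i^n\overset{D_i}{\to}f_i$, then $D_i(a,f_i)\le\liminf_{n\to\infty}D_i(a^n,f_i^n)$. (3) $R$ is lower semi-continuous w.r.t. $\tau_X$. (4) Each $T_i$ is continuous from $(X,\tau_X)$ (on $\operatorname{dom}(T_i)$) to $(Y_i,\tau_{Y_i})$ and $\operatorname{dom}(T_i)$ is closed w.r.t. convergence in $\tau_X$. (5) For any $\lambda\in(0,\infty)^N$: whenever $f^n\overset{D}{\to}f$ and $J_\lambda(u^n,f^n)<c$ for all $n$ and some constant $c$, the sequence $(u^n)_n$ admits a $\tau_X$-convergent subsequence. Notation: $x^n=o(y^n)$ means $x^n/y^n\to0$.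
   Formalization: The formal statement additionally requires that the J_{λ†,I^c}-minimal solution has finite value and that D_i(f_i†,f_i†)=0 for i in I^c; without either, the claim fails (R≡∞, or D≡1 with R=0, T=id on the real line, u^n=n). *)

(* Defs.v *)
From HB Require Import structures.
From mathcomp Require Import all_boot all_order all_algebra.
From mathcomp Require Import all_classical all_reals all_analysis.

Set Implicit Arguments.
Unset Strict Implicit.
Unset Printing Implicit Defensive.

Import Order.TTheory GRing.Theory Num.Theory.
Import numFieldNormedType.Exports.

Local Open Scope classical_set_scope.
Local Open Scope ring_scope.
Local Open Scope ereal_scope.

(* A topology on the carrier A, as first-class data: X and the Y_i come with
   their norm topology as canonical structure, and tau_X, tau_{Y_i}, tau_{D_i}
   are further topologies on the same carriers.  The library's class also
   records an eqType/choiceType structure, which is not used. *)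
Definition topology_on (A : Type) := Topological.axioms_ A.

Definition with_topology (A : Type) (tau : topology_on A) : topologicalType :=
  Topological.Pack tau.

Definition cvg_seq (S : topologicalType) (a : nat -> S) (l : S) : Prop :=
  a @ \oo --> l.

Definition cvg_in (A : Type) (tau : topology_on A) (a : nat -> A) (l : A) :=
  @cvg_seq (with_topology tau) a l.

Definition continuous_on (S S' : topologicalType) (A : set S) (f : S -> S') :=
  {within A, continuous f}.

(* The operators T_i are total functions together with their domains; their
   values outside the domains are irrelevant. *)
Record setting (R : realType) (N : nat) := Setting {
  spX : completeNormedModType R;
  Reg : spX -> \bar R;
  Reg_ge0 : forall u, 0 <= Reg u;
  spY : 'I_N -> normedModType R;
  Dis : forall i, spY i -> spY i -> \bar R;
  Dis_ge0 : forall i a b, 0 <= @Dis i a b;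
  domT : 'I_N -> set spX;
  opT : forall i, spX -> spY i;
  tauX : topology_on spX;
  tauX_hausdorff : hausdorff_space (with_topology tauX);
  tauY : forall i, topology_on (spY i);
  tauY_hausdorff : forall i, hausdorff_space (with_topology (tauY i));
  tauD : forall i, topology_on (spY i)
}.

Arguments Reg {R N} s _.
Arguments spX {R N} s.
Arguments spY {R N} s _.
Arguments Dis {R N} s i _ _.
Arguments domT {R N} s i.
Arguments opT {R N} s i _.
Arguments tauX {R N} s.
Arguments tauY {R N} s i.
Arguments tauD {R N} s i.

(* The product space Y = Y_1 x ... x Y_N. *)
Definition prodY (R : realType) (N : nat) (P : setting R N) : Type :=
  forall i : 'I_N, spY P i.

Definition dom (R : realType) (N : nat) (P : setting R N) : set (spX P) :=
  [set u | forall i, domT P i u].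

Arguments dom {R N} P _.

(* The library's product on \bar R satisfies +oo * 0 = 0 and +oo * d = +oo for
   d > 0, which is the convention for the weight lambda_i = +oo. *)
Definition J (R : realType) (N : nat) (P : setting R N)
    (lam : 'I_N -> \bar R) (u : spX P) (f : prodY P) : \bar R :=
  \sum_(i < N) lam i * Dis P i (opT P i u) (f i) + Reg P u.

(* J_on A is J_{lambda, A}; it is used with A the complement of I. *)
Definition J_on (R : realType) (N : nat) (P : setting R N) (A : {set 'I_N})
    (lam : 'I_N -> \bar R) (u : spX P) (f : prodY P) : \bar R :=
  Reg P u + \sum_(i in A) lam i * Dis P i (opT P i u) (f i).

Definition minimizer (R : realType) (A : Type) (S : set A) (F : A -> \bar R)
    (x : A) : Prop :=
  S x /\ forall y, S y -> F x <= F y.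

(* {u in dom(T) : T_I u = f_I} *)
Definition feasible (R : realType) (N : nat) (P : setting R N)
    (I : {set 'I_N}) (f : prodY P) : set (spX P) :=
  [set u | dom P u /\ forall i, i \in I -> opT P i u = f i].

(* As usual for extended-valued functionals, a minimal solution has a finite
   value; otherwise any feasible point would qualify when the functional is
   identically +oo on the feasible set. *)
Definition minimal_solution (R : realType) (N : nat) (P : setting R N)
    (I : {set 'I_N}) (lam : 'I_N -> \bar R) (f : prodY P) (u : spX P) : Prop :=
  minimizer (feasible I f) (fun v => J_on (~: I) lam v f) u /\
  J_on (~: I) lam u f < +oo.

(* f^n -> f in D_i *)
Definition D_cvg (R : realType) (N : nat) (P : setting R N) (i : 'I_N)
    (f : nat -> spY P i) (g : spY P i) : Prop :=
  (Dis P i g (f n) @[n --> \oo] --> 0) /\ cvg_in (tauD P i) f g.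

Record assumptionG (R : realType) (N : nat) (P : setting R N) : Prop :=
  AssumptionG {
  G1 : forall i (a b : spY P i), Dis P i a b = 0 -> a = b;
  G2 : forall i (a_ : nat -> spY P i) (a : spY P i)
         (f_ : nat -> spY P i) (f : spY P i),
       cvg_in (tauY P i) a_ a -> D_cvg f_ f ->
       Dis P i a f <= limn_einf (fun n => Dis P i (a_ n) (f_ n));
  G3 : @lower_semicontinuous (with_topology (tauX P)) R (Reg P);
  G4_continuous : forall i,
       @continuous_on (with_topology (tauX P)) (with_topology (tauY P i))
         (domT P i) (opT P i);
  G4_closed : forall i (u_ : nat -> spX P) (u : spX P),
       (forall n, domT P i (u_ n)) -> cvg_in (tauX P) u_ u -> domT P i u;
  (* J_lambda(u, f) is only defined for u in dom(T), hence dom P (u_ n) *)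
  G5 : forall (lam : 'I_N -> R), (forall i, (0 < lam i)%R) ->
       forall (f_ : nat -> prodY P) (f : prodY P) (u_ : nat -> spX P) (c : R),
       (forall i, D_cvg (fun n => f_ n i) (f i)) ->
       (forall n, dom P (u_ n)) ->
       (forall n, J (fun i => (lam i)%:E) (u_ n) (f_ n) < c%:E) ->
       exists (phi : nat -> nat) (u : spX P),
         increasing_seq phi /\ cvg_in (tauX P) (u_ \o phi) u
}.

(* x^n = o(y^n), i.e. x^n / y^n -> 0 *)
Definition little_o (R : realType) (x : nat -> \bar R) (y : nat -> R) : Prop :=
  x n * ((y n)^-1)%:E @[n --> \oo] --> 0.

(* Main.v *)
Require Import Defs.
From HB Require Import structures.
From mathcomp Require Import all_boot all_order all_algebra.
From mathcomp Require Import all_classical all_reals all_analysis.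
From mathcomp Require Import lra.

Set Implicit Arguments.
Unset Strict Implicit.
Unset Printing Implicit Defensive.

Import Order.TTheory GRing.Theory Num.Theory.
Import numFieldNormedType.Exports.

Local Open Scope classical_set_scope.
Local Open Scope ring_scope.
Local Open Scope ereal_scope.

(** The minimality of u^n bounds its energy by that of a minimal solution u0 of
    the limit problem.  As T_I u0 = f_I^dagger, the data terms of u0 with index
    in I are lambda_i^n (delta_i^n)^(p_i), which vanish, so this bound tends to
    m, the finite minimal value of the limit problem ([J_data_convergence]).

    Compactness follows because the weights in I eventually exceed 1: the
    functional with weight 1 on I and lambda_i^dagger elsewhere is then bounded
    along (u^n), and its weights no longer depend on n.

    Let v be the limit of a convergent subsequence.  A weight tending to
    infinity times a discrepancy stays bounded, so the discrepancies in I tend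
    to 0 and v satisfies T_I v = f_I^dagger
    ([eventually_above_diverging_weight]).  Each summand of the energy has a
    limit inferior at least equal to its value at v, where the weighted terms
    in I count as 0.  These lower bounds add up to the limit energy of v, which
    is at least m, whereas the energies of the sequence have limit superior at
    most m.  Hence no summand can exceed its lower bound in the limit: each of
    them converges to it ([cvg_of_sum_le], [limit_of_bounded_energies]).  This
    yields at once the little-o estimate in I, the convergence of the other
    discrepancies and of R, and the minimality of v. *)

(** * Lower bounds on limits inferior *)

(** This is b <= liminf a, unfolded so that a sum of nonnegative lower bounds
    can be treated by splitting r, and so that lower semicontinuity of R yields
    it directly. *)
Definition eventually_above (R : realType) (a : nat -> \bar R) (b : \bar R) :=
  forall r : R, r%:E < b -> \forall n \near \oo, r%:E < a n.

Lemma eventually_above_limn_einf (R : realType) (a : nat -> \bar R)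
    (b : \bar R) :
  b <= limn_einf a -> eventually_above a b.
Proof.
move=> ba r rb; have := lt_le_trans rb ba; rewrite limn_einf_lim => rlim.
have /cvg_ex[l al] := @is_cvg_einfs R a.
rewrite (cvg_lim _ al)// in rlim.
near=> n; apply: (@lt_le_trans _ _ (einfs a n)).
  by near: n; apply: (al [set y | r%:E < y]); exact: open_ereal_gt'.
by apply: ereal_inf_lbound; exists n => /=.
Unshelve. all: by end_near. Qed.

Lemma cvg_eventually_lt (R : realType) (a : nat -> \bar R) (l r : \bar R) :
  a n @[n --> \oo] --> l -> l < r -> \forall n \near \oo, a n < r.
Proof.
by move=> al lr; apply: (al [set y | y < r]); exact: open_ereal_lt'.
Qed.

(** Nonnegativity keeps the sum away from +oo - oo, so that a real number below
    A + B splits into one below A and one below B. *)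
Lemma eventually_aboveD (R : realType) (a b : nat -> \bar R) (A B : \bar R) :
  0 <= A -> 0 <= B ->
  eventually_above a A -> eventually_above b B ->
  eventually_above (fun n => a n + b n) (A + B).
Proof.
move=> A0 B0 aA bB r rAB.
have [s [t [sA tB rst]]] :
    exists s t : R, [/\ s%:E < A, t%:E < B & r = (s + t)%R].
  case: A B A0 B0 rAB {aA bB} => [A| |//] [B| |//] _ _ rAB.
  - move: rAB; rewrite -EFinD lte_fin => rAB.
    exists (A - (A + B - r) / 2)%R, (B - (A + B - r) / 2)%R.
    rewrite !lte_fin; split; lra.
  - exists (A - 1)%R, (r - (A - 1))%R; rewrite lte_fin ltry; split => //; lra.
  - exists (r - (B - 1))%R, (B - 1)%R; rewrite lte_fin ltry; split => //; lra.
  - by exists r, 0%R; rewrite !ltry addr0.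
near=> n; rewrite rst EFinD; apply: lteD.
- by near: n; exact: aA.
- by near: n; exact: bB.
Unshelve. all: by end_near. Qed.

Lemma eventually_above_sum (R : realType) (K : Type) (s : seq K)
    (P : pred K) (a : nat -> K -> \bar R) (A : K -> \bar R) :
  (forall k, P k -> 0 <= A k) ->
  (forall k, P k -> eventually_above (a ^~ k) (A k)) ->
  eventually_above (fun n => \sum_(k <- s | P k) a n k)
                   (\sum_(k <- s | P k) A k).
Proof.
move=> A0 aA; elim: s => [|k s IH].
  rewrite big_nil => r r0; apply: nearW => n; by rewrite big_nil.
rewrite big_cons; under eq_fun do rewrite big_cons.
case: ifPn => // Pk; apply: eventually_aboveD => //.
- exact: A0.
- exact: sume_ge0.
- exact: aA.
Qed.

Lemma eventually_aboveZ (R : realType) (k : R) (a : nat -> \bar R)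
    (A : \bar R) :
  (0 < k)%R -> eventually_above a A ->
  eventually_above (fun n => k%:E * a n) (k%:E * A).
Proof.
move=> k0 aA r; rewrite -lte_pdivrMl// -EFinM => /aA.
by apply: filterS => n; rewrite EFinM lte_pdivrMl.
Qed.

Lemma exists_real_between (R : realType) (x y : \bar R) :
  x < y -> exists2 r : R, x < r%:E & r%:E < y.
Proof.
case: x y => [x| |] [y| |] //.
- by rewrite lte_fin => xy; exists ((x + y) / 2)%R; rewrite lte_fin; lra.
- by move=> _; exists (x + 1)%R; rewrite ?ltry// lte_fin; lra.
- by move=> _; exists (y - 1)%R; rewrite ?ltNyr// lte_fin; lra.
- by move=> _; exists 0%R; rewrite ?ltry ?ltNyr.
Qed.

Lemma eventually_above_le_cvg (R : realType) (a c : nat -> \bar R)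
    (A m : \bar R) :
  eventually_above a A -> (\forall n \near \oo, a n <= c n) ->
  c n @[n --> \oo] --> m -> A <= m.
Proof.
move=> aA ac cm; rewrite leNgt; apply/negP => /exists_real_between[r mr rA].
have cr := cvg_eventually_lt cm mr.
suff : \forall n \near \oo, False by move=> /filter_ex[].
near=> n; have : r%:E < r%:E; last by rewrite ltxx.
apply: (@lt_trans _ _ (c n)); last by near: n.
apply: (@lt_le_trans _ _ (a n)); near: n => //; exact: aA.
Unshelve. all: by end_near. Qed.

(** When the lower bounds A and B already use up the whole limit m of an upper
    bound for a + b, any excess of a over A would have to be compensated by b
    falling below B. *)
Lemma cvg_of_sum_le (R : realType) (a b c : nat -> \bar R) (A B m : \bar R) :
  0 <= A -> 0 <= B ->
  eventually_above a A -> eventually_above b B ->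
  (\forall n \near \oo, a n + b n <= c n) -> c n @[n --> \oo] --> m ->
  m <= A + B -> m < +oo ->
  a n @[n --> \oo] --> A.
Proof.
move=> A0 B0 aA bB abc cm mAB moo.
have /le_lt_trans/(_ moo) : A + B <= m.
  by apply: eventually_above_le_cvg abc cm; exact: eventually_aboveD.
case: A B A0 B0 aA bB mAB => [A| |//] [B| |//] // A0 B0 aA bB mAB _.
have close (e : R) : (0 < e)%R ->
    \forall n \near \oo, (A - e)%:E < a n < (A + e)%:E.
  move=> e0; near=> n.
  (* the budget e is split evenly between b and c *)
  have an : (A - e)%:E < a n by near: n; apply: aA; rewrite lte_fin; lra.
  have bn : (B - e / 2)%:E < b n by near: n; apply: bB; rewrite lte_fin; lra.
  have cn : c n < (A + B + e / 2)%:E.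
    near: n; apply: cvg_eventually_lt cm _.
    by apply: le_lt_trans mAB _; rewrite -EFinD lte_fin; lra.
  have : a n + b n < (A + B + e / 2)%:E.
    by apply: le_lt_trans cn; near: n.
  rewrite an /=; case: (a n) (b n) an bn => [x| |] [y| |] //=.
  by rewrite -EFinD !lte_fin; lra.
apply/fine_cvgP; split.
  apply: filterS (close 1%R ltr01) => n /andP[].
  by case: (a n).
apply/cvgrPdist_lt => e /close; apply: filterS => n /= /andP[].
case: (a n) => [x| |] //=; rewrite !lte_fin => Ax xA.
by rewrite ltr_distlC Ax.
Unshelve. all: by end_near. Qed.

(** * Sequential consequences of the topological assumptions *)

Lemma increasing_seq_cvgn (phi : nat -> nat) :
  increasing_seq phi -> phi n @[n --> \oo] --> \oo.
Proof.
move=> /increasing_seqP phiS.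
have phi_ge n : (n <= phi n)%N.
  by elim: n => // n /leq_ltn_trans; apply; have := phiS n; rewrite ltEnat.
apply/cvgnyPge => M; near=> n; apply: leq_trans (phi_ge n).
by near: n; exact: nbhs_infty_ge.
Unshelve. all: by end_near. Qed.

Lemma lower_semicontinuous_eventually_above (R : realType)
    (S : topologicalType) (F : S -> \bar R) (w : nat -> S) (v : S) :
  lower_semicontinuous F -> cvg_seq w v -> eventually_above (F \o w) (F v).
Proof.
move=> Flsc wv r /Flsc[V Vv FV].
by near=> n; apply: FV; near: n; exact: wv.
Unshelve. all: by end_near. Qed.

Lemma continuous_on_cvg_seq (S S' : topologicalType) (A : set S) (f : S -> S')
    (w : nat -> S) (v : S) :
  continuous_on A f -> A v -> (forall n, A (w n)) -> cvg_seq w v ->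
  cvg_seq (f \o w) (f v).
Proof.
move=> fA Av Aw wv U Ufv.
have AU : within A (nbhs v) (f @^-1` U).
  by rewrite (nbhs_subspace_in Av); exact: fA.
rewrite nbhs_simpl /=; near=> n; suff : A (w n) -> U (f (w n)) by apply.
by near: n; exact: wv AU.
Unshelve. all: by end_near. Qed.

Lemma D_cvg_comp (R : realType) (N : nat) (P : setting R N) (i : 'I_N)
    (f : nat -> spY P i) (g : spY P i) (phi : nat -> nat) :
  phi n @[n --> \oo] --> \oo -> D_cvg f g -> D_cvg (f \o phi) g.
Proof.
move=> phioo [Df tf]; split.
- exact: (cvg_comp _ _ phioo Df).
- exact: (@cvg_comp _ _ (with_topology (tauD P i)) _ _ _ _ _ phioo tf).
Qed.

Lemma D_cvg_cst (R : realType) (N : nat) (P : setting R N) (i : 'I_N)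
    (f : nat -> spY P i) (g : spY P i) :
  Dis P i g g = 0 -> (forall n, f n = g) -> D_cvg f g.
Proof.
move=> gg fg; rewrite (funext fg : f = fun=> g).
split; first by rewrite gg; exact: cvg_cst.
exact: (@cvg_cst (with_topology (tauD P i)) g _ \oo).
Qed.

(** * The functionals *)

(** The terms with index in I are kept as zeros so that both functionals are
    sums over the same index set and can be compared term by term. *)
Lemma J_onE (R : realType) (N : nat) (P : setting R N) (I : {set 'I_N})
    (lam : 'I_N -> \bar R) (u : spX P) (f : prodY P) :
  J_on (~: I) lam u f =
  \sum_(i < N) (if i \in I then 0 else lam i * Dis P i (opT P i u) (f i))
  + Reg P u.
Proof.
rewrite /J_on addeC big_mkcond; congr (_ + _); apply: eq_bigr => i _.
by rewrite finset.in_setC; case: (i \in I).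
Qed.

Lemma J_on_le_J (R : realType) (N : nat) (P : setting R N) (I : {set 'I_N})
    (lam : 'I_N -> \bar R) (u : spX P) (f : prodY P) :
  (forall i, 0 <= lam i) -> J_on (~: I) lam u f <= J lam u f.
Proof.
move=> lam0; rewrite J_onE leeD2r//; apply: lee_sum => i _.
by case: ifP => // _; rewrite mule_ge0// Dis_ge0.
Qed.

Lemma fidelity_le_J (R : realType) (N : nat) (P : setting R N)
    (lam : 'I_N -> \bar R) (u : spX P) (f : prodY P) (i : 'I_N) :
  (forall j, 0 <= lam j) ->
  lam i * Dis P i (opT P i u) (f i) <= J lam u f.
Proof.
move=> lam0; rewrite /J (bigD1 i)//= -addeA leeDl//.
by rewrite adde_ge0 ?Reg_ge0// sume_ge0// => j _; rewrite mule_ge0// Dis_ge0.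
Qed.

Lemma J_le_weights (R : realType) (N : nat) (P : setting R N)
    (lam lam' : 'I_N -> \bar R) (u : spX P) (f : prodY P) :
  (forall i, lam i <= lam' i) -> J lam u f <= J lam' u f.
Proof.
move=> le_lam; rewrite leeD2r//; apply: lee_sum => i _.
by apply: lee_wpmul2r => //; exact: Dis_ge0.
Qed.

(** * Limits of sequences with converging energy bounds *)

Lemma dom_cvg (R : realType) (N : nat) (P : setting R N)
    (HG : assumptionG P) (w : nat -> spX P) (v : spX P) :
  (forall n, dom P (w n)) -> cvg_in (tauX P) w v -> dom P v.
Proof. by move=> wP wv i; apply: (G4_closed HG _ wv) => n; exact: wP. Qed.

Lemma fidelity_eventually_above (R : realType) (N : nat) (P : setting R N)
    (HG : assumptionG P) (g : nat -> prodY P) (fdag : prodY P)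
    (w : nat -> spX P) (v : spX P) (i : 'I_N) :
  D_cvg (g ^~ i) (fdag i) -> (forall n, dom P (w n)) ->
  cvg_in (tauX P) w v ->
  eventually_above (fun n => Dis P i (opT P i (w n)) (g n i))
                   (Dis P i (opT P i v) (fdag i)).
Proof.
move=> gf wP wv; apply: eventually_above_limn_einf.
apply: (G2 HG _ gf).
apply: (@continuous_on_cvg_seq (with_topology (tauX P))
  (with_topology (tauY P i)) _ _ w v (@G4_continuous _ _ _ HG i) _ _ wv).
- by have := dom_cvg HG wP wv; apply.
- by move=> n; exact: wP.
Qed.

(** If A were positive, a would stay above some r > 0, and l n * r would outgrow
    every bound M on c. *)
Lemma eventually_above_diverging_weight (R : realType) (l : nat -> R)
    (a c : nat -> \bar R) (A m : \bar R) :
  (l n)%:E @[n --> \oo] --> +oo -> eventually_above a A ->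
  (forall n, (l n)%:E * a n <= c n) -> c n @[n --> \oo] --> m -> m < +oo ->
  A <= 0.
Proof.
move=> loo aA lac cm /exists_real_between[M mM _].
rewrite leNgt; apply/negP => /exists_real_between[r]; rewrite lte_fin => r0 rA.
suff : \forall n \near \oo, False by move=> /filter_ex[].
near=> n; have : M%:E < M%:E; last by rewrite ltxx.
have cM : c n < M%:E by near: n; exact: cvg_eventually_lt cm mM.
apply: le_lt_trans cM; apply: le_trans (lac n).
have ln : (Num.max 0 (M / r))%:E < (l n)%:E by near: n; exact: cvgey_gt loo _.
move: ln; rewrite lte_fin gt_max => /andP[l0 Mr].
apply: (@le_trans _ _ ((l n)%:E * r%:E)).
  by rewrite -EFinM lee_fin -ler_pdivrMr// ltW.
by rewrite lee_pmul2l// ltW//; near: n; exact: aA.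
Unshelve. all: by end_near. Qed.

(** The energies of w are only compared with a sequence c that tends to the
    lower bound m of the limit problem; w need not be a sequence of minimizers.
    Each weighted term and R tend separately to their values at v because
    together they have no room left above m.  The identity D_i(f_i, f_i) = 0 for
    i in I is a conclusion, since D_i need not vanish on the diagonal: it holds
    because D_i(T_i v, f_i) = 0 forces T_i v = f_i. *)
Lemma limit_of_bounded_energies (R : realType) (N : nat) (P : setting R N)
    (HG : assumptionG P) (I : {set 'I_N}) (fdag : prodY P)
    (lamdag : 'I_N -> \bar R) (g : nat -> prodY P) (l : nat -> 'I_N -> R)
    (w : nat -> spX P) (v : spX P) (c : nat -> \bar R) (m : \bar R) :
  (forall n i, (0 < l n i)%R) ->
  (forall n i, i \notin I -> (l n i)%:E = lamdag i) ->
  (forall i, i \in I -> (l n i)%:E @[n --> \oo] --> +oo) ->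
  (forall i, D_cvg (g ^~ i) (fdag i)) ->
  (forall n, dom P (w n)) ->
  (forall n, J (fun i => (l n i)%:E) (w n) (g n) <= c n) ->
  c n @[n --> \oo] --> m -> m < +oo ->
  (forall v', feasible I fdag v' -> m <= J_on (~: I) lamdag v' fdag) ->
  cvg_in (tauX P) w v ->
  [/\ feasible I fdag v,
      forall i, i \in I -> Dis P i (fdag i) (fdag i) = 0,
      J_on (~: I) lamdag v fdag <= m,
      Reg P (w n) @[n --> \oo] --> Reg P v &
      forall i, (l n i)%:E * Dis P i (opT P i (w n)) (g n i) @[n --> \oo]
        --> if i \in I then 0 else lamdag i * Dis P i (opT P i v) (fdag i)].
Proof.
move=> l0 lI loo gf wP wc cm moo mmin wv.
have Dv i : eventually_above (fun n => Dis P i (opT P i (w n)) (g n i))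
    (Dis P i (opT P i v) (fdag i)) by exact: fidelity_eventually_above.
have Rv : eventually_above (Reg P \o w) (Reg P v).
  exact: lower_semicontinuous_eventually_above (G3 HG) wv.
have DvI i : i \in I -> Dis P i (opT P i v) (fdag i) = 0.
  move=> iI; apply/eqP; rewrite eq_le Dis_ge0 andbT.
  apply: eventually_above_diverging_weight (loo i iI) (Dv i) _ cm moo => n.
  apply: le_trans (wc n).
  apply: (@fidelity_le_J _ _ P (fun i => (l n i)%:E)) => j.
  by rewrite lee_fin ltW.
have vI i : i \in I -> opT P i v = fdag i by move=> /DvI /(G1 HG).
have feas : feasible I fdag v by split => //; exact: dom_cvg wP wv.
(* a are the weighted terms, b their lower bounds at v *)
pose a n i := (l n i)%:E * Dis P i (opT P i (w n)) (g n i).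
pose b i := if i \in I then 0 else lamdag i * Dis P i (opT P i v) (fdag i).
have a0 n i : 0 <= a n i by rewrite mule_ge0 ?Dis_ge0// lee_fin ltW.
have b0 i : 0 <= b i.
  rewrite /b; case: ifPn => // /(lI 0%N) <-.
  by rewrite mule_ge0 ?Dis_ge0// lee_fin ltW.
have ab i : eventually_above (a ^~ i) (b i).
  rewrite /b; case: ifPn => [_ r r0|iI].
    by apply: nearW => n; exact: lt_le_trans r0 (a0 n i).
  rewrite -(lI 0%N)//; have -> : a ^~ i =
    (fun n => (l 0%N i)%:E * Dis P i (opT P i (w n)) (g n i)).
    by apply/funext => n; rewrite /a !lI.
  exact: eventually_aboveZ.
have mb : m <= \sum_(i < N) b i + Reg P v by rewrite -J_onE; exact: mmin.
have ab_sum (Q : pred 'I_N) : eventually_above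
    (fun n => \sum_(i < N | Q i) a n i) (\sum_(i < N | Q i) b i).
  by apply: eventually_above_sum => i _.
have b_sum0 (Q : pred 'I_N) : 0 <= \sum_(i < N | Q i) b i by exact: sume_ge0.
split => //.
- by move=> i iI; rewrite -(DvI i iI) vI.
- rewrite J_onE; apply: eventually_above_le_cvg _ _ cm.
    apply: eventually_aboveD (ab_sum xpredT) Rv => //; exact: Reg_ge0.
  by apply: nearW => n; exact: wc.
- apply: cvg_of_sum_le Rv (ab_sum xpredT) _ cm _ moo => //.
  + exact: Reg_ge0.
  + by apply: nearW => n; rewrite addeC; exact: wc.
  + by rewrite addeC.
- move=> i; apply: cvg_of_sum_le (ab i)
    (eventually_aboveD _ _ (ab_sum (fun j => j != i)) Rv) _ cm _ moo => //.
  + by rewrite adde_ge0 ?Reg_ge0.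
  + exact: Reg_ge0.
  + apply: nearW => n; apply: le_trans (wc n).
    by rewrite /J [X in _ <= X + _](bigD1 i)//= -addeA.
  + by move: mb; rewrite (bigD1 i)//= -addeA.
Qed.

(** * Stability and convergence for vanishing noise *)

(** On a feasible point the terms with index in I reduce to the weighted noise
    levels, and the other terms do not depend on n. *)
Lemma J_data_convergence (R : realType) (N : nat) (P : setting R N)
    (I : {set 'I_N}) (fdag : prodY P) (lamdag : 'I_N -> \bar R)
    (f : nat -> prodY P) (lam : nat -> 'I_N -> R) (u : spX P) :
  (forall n i, (0 < lam n i)%R) ->
  (forall n i, i \notin I -> f n i = fdag i) ->
  (forall n i, i \notin I -> (lam n i)%:E = lamdag i) ->
  (forall i, i \in I ->
     (lam n i)%:E * Dis P i (fdag i) (f n i) @[n --> \oo] --> 0) ->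
  feasible I fdag u ->
  J (fun i => (lam n i)%:E) u (f n) @[n --> \oo]
    --> J_on (~: I) lamdag u fdag.
Proof.
move=> lam0 fI lamI lamD [_ uI]; rewrite J_onE.
have t0 n i : 0 <= (lam n i)%:E * Dis P i (opT P i u) (f n i).
  by rewrite mule_ge0 ?Dis_ge0// lee_fin ltW.
apply: cvgeD.
- apply: ge0_adde_def; rewrite inE ?Reg_ge0//; apply: sume_ge0 => i _.
  by case: ifPn => // /(lamI 0%N) <-; rewrite mule_ge0 ?Dis_ge0// lee_fin ltW.
- apply: cvg_nnesum => i _; first exact: nearW.
  case: ifPn => iI; first by rewrite uI//; exact: lamD.
  by under eq_fun do rewrite lamI// fI//; exact: cvg_cst.
- exact: cvg_cst.
Qed.

Theorem corollary2p8 (R : realType) (N : nat) (P : setting R N)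
  (HG : assumptionG P)
  (I : {set 'I_N}) (fdag : prodY P) (f : nat -> prodY P)
  (f_const : forall n i, i \notin I -> f n i = fdag i)
  (f_cvg : forall i, i \in I -> D_cvg (fun n => f n i) (fdag i))
  (* the constant data sequences (i not in I) also converge in D_i *)
  (fdag_self : forall i, i \notin I -> Dis P i (fdag i) (fdag i) = 0)
  (p : 'I_N -> R) (p_ge1 : forall i, i \in I -> (1 <= p i)%R)
  (delta : nat -> 'I_N -> \bar R)
  (deltaE : forall n i, delta n i =
     if i \in I then poweR (Dis P i (fdag i) (f n i)) (p i)^-1 else 0)
  (lam : nat -> 'I_N -> R) (lam_gt0 : forall n i, (0 < lam n i)%R)
  (lamdag : 'I_N -> \bar R)
  (lam_const : forall n i, i \notin I -> (lam n i)%:E = lamdag i)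
  (lam_pinfty : forall i, i \in I -> (lam n i)%:E @[n --> \oo] --> +oo)
  (lam_delta : forall i, i \in I ->
     (lam n i)%:E * poweR (delta n i) (p i) @[n --> \oo] --> 0)
  (lam_cvg : forall i, (lam n i)%:E @[n --> \oo] --> lamdag i)
  (exists_minimal : exists u : spX P, minimal_solution I lamdag fdag u)
  (u : nat -> spX P)
  (u_sol : forall n,
     minimizer (dom P) (fun v => J (fun i => (lam n i)%:E) v (f n)) (u n)) :
  (exists (phi : nat -> nat) (udag : spX P),
     increasing_seq phi /\
     cvg_in (tauX P) (u \o phi) udag /\
     (forall i, i \in I ->
        little_o (fun n => Dis P i (opT P i (u (phi n))) (f (phi n) i))
                 (fun n => (lam (phi n) i)^-1)%R) /\
     (forall i, i \notin I ->
        Dis P i (opT P i (u (phi n))) (fdag i) @[n --> \oo]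
          --> Dis P i (opT P i udag) (fdag i)) /\
     (Reg P (u (phi n)) @[n --> \oo] --> Reg P udag)) /\
  (forall (psi : nat -> nat) (v : spX P),
     increasing_seq psi -> cvg_in (tauX P) (u \o psi) v ->
     minimizer (feasible I fdag) (fun w => J lamdag w fdag) v).
Proof.
case: exists_minimal => u0 [[u0feas u0min] u0fin].
set m := J_on (~: I) lamdag u0 fdag in u0min u0fin.
pose c n := J (fun i => (lam n i)%:E) u0 (f n).
have Jc n : J (fun i => (lam n i)%:E) (u n) (f n) <= c n.
  by apply: (u_sol n).2; exact: u0feas.1.
have cm : c n @[n --> \oo] --> m.
  apply: J_data_convergence => // i iI; have := lam_delta i iI.
  have p0 : p i != 0%R by rewrite gt_eqF// (lt_le_trans ltr01)// p_ge1.
  under eq_fun do rewrite deltaE iI -poweRrM mulVf// poweRe1 ?Dis_ge0//.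
  by [].
have f_Dcvg i : D_cvg (f ^~ i) (fdag i).
  have [iI|iI] := boolP (i \in I); first exact: f_cvg.
  by apply: D_cvg_cst => [|n]; [exact: fdag_self|exact: f_const].
have uP n : dom P (u n) := (u_sol n).1.
have limit phi v : increasing_seq phi -> cvg_in (tauX P) (u \o phi) v ->
    [/\ feasible I fdag v,
      forall i, i \in I -> Dis P i (fdag i) (fdag i) = 0,
      J_on (~: I) lamdag v fdag <= m,
      Reg P (u (phi n)) @[n --> \oo] --> Reg P v &
      forall i, (lam (phi n) i)%:E *
          Dis P i (opT P i (u (phi n))) (f (phi n) i) @[n --> \oo]
        --> if i \in I then 0 else lamdag i * Dis P i (opT P i v) (fdag i)].
  move=> /increasing_seq_cvgn phioo uv.
  apply: (@limit_of_bounded_energies _ _ _ HG I fdag lamdag (f \o phi)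
    (lam \o phi) (u \o phi) v (c \o phi) m) => //=.
  - by move=> n i; exact: lam_const.
  - by move=> i iI; exact: (cvg_comp _ _ phioo (lam_pinfty i iI)).
  - by move=> i; exact: D_cvg_comp (f_Dcvg i).
  - exact: cvg_comp phioo cm.
have lamdag_ge0 i : 0 <= lamdag i.
  apply: cvge_ge (lam_cvg i); apply: nearW => n; by rewrite lee_fin ltW.
split; last first.
  move=> psi v psiS /(limit _ _ psiS)[vfeas fdagI vm _ _]; split => // w wfeas.
  apply: le_trans (le_trans (u0min w wfeas) (J_on_le_J _ _ _ lamdag_ge0)).
  apply: le_trans vm; rewrite J_onE leeD2r//; apply: lee_sum => i _.
  by case: ifPn => // iI; rewrite vfeas.2// fdagI// mule0.
(* The compactness assumption concerns fixed weights and a bound valid for all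
   n, hence weights lam1 that lam n dominates from some n0 on, and a shift of
   the sequence by n0. *)
pose lam1 i := if i \in I then 1%R else lam 0%N i.
have lam1_gt0 i : (0 < lam1 i)%R by rewrite /lam1; case: ifP.
have [M mM _] := exists_real_between u0fin.
have [n0 _ n0P] : \forall n \near \oo,
    (forall i, (lam1 i <= lam n i)%R) /\ c n < M%:E.
  near=> n; split; last by near: n; exact: cvg_eventually_lt cm mM.
  near: n; apply: filter_forall => i; rewrite /lam1; case: ifPn => iI.
    near=> n; rewrite -lee_fin ltW//; near: n.
    exact: cvgey_gt (lam_pinfty i iI) _.
  by apply: nearW => n; rewrite -lee_fin !lam_const.
have shift_oo : (n + n0)%N @[n --> \oo] --> \oo by exact: cvg_addnr.
have [phi [v [phiS uv]]] : exists (phi : nat -> nat) (v : spX P),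
    increasing_seq phi /\
    cvg_in (tauX P) ((fun n => u (n + n0)%N) \o phi) v.
  apply: (G5 HG lam1_gt0 (f_ := fun n => f (n + n0)%N) (f := fdag) (c := M)).
  - by move=> i; exact: D_cvg_comp shift_oo (f_Dcvg i).
  - by move=> n; exact: uP.
  - move=> n; have [lam1_le cM] := n0P (n + n0)%N (leq_addl _ _).
    apply: le_lt_trans cM; apply: le_trans (Jc _).
    by apply: J_le_weights => i; rewrite lee_fin.
have phi'S : increasing_seq (fun n => phi n + n0)%N.
  by move=> a b; rewrite leEnat leq_add2r -leEnat phiS.
have [_ _ _ Ru Du] := limit _ v phi'S uv.
exists (fun n => phi n + n0)%N, v; do 2!split => //; split.
  move=> i iI; have := Du i; rewrite iI /little_o.
  by under [in X in _ -> X]eq_fun do rewrite invrK muleC.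
split => // i iI; have := Du i; rewrite (negPf iI) -(lam_const 0%N)//.
(* the weight is constant in n here and can be divided out *)
have l0 := lam_gt0 0%N i.
move=> /(@cvgeZl _ _ _ _ _ ((lam 0%N i)^-1)%:E isT).
rewrite muleA -EFinM mulVf ?gt_eqF// mul1e.
under eq_fun do rewrite f_const// lam_const// -(lam_const 0%N)// muleA -EFinM
  mulVf ?gt_eqF// mul1e.
by [].
Unshelve. all: by end_near. Qed.
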